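(* Let $\mathcal R$ be a top tree of height $h$ over $(T,\partial T)$, and let $\mathrm{select}$ be any function that, given a root cluster with two children, returns one of them. If $|\partial T|\le 1$, then after $O(h)$ calls to $\mathrm{select}$, $\mathrm{join}$ and $\mathrm{split}$ there is a unique edge $(v,w)$ contained in every cluster chosen by $\mathrm{select}$, and this edge is returned; afterwards the top tree is restored to its original state with $O(h)$ calls to $\mathrm{join}$ and $\mathrm{split}$. Here the search proceeds down $\mathcal R$: while the current cluster $C$ of $\mathcal R$ (initially the root) is not a single edge, with children $A,B$ in $\mathcal R$, $\mathrm{select}$ is called on a root cluster $\mathrm{join}(A^*,B^* )$ with $A\subseteq A^*$, $B\subseteq B^*$, $A^*\cup B^*=T$, and the new current cluster is $A$ or $B$ according to whether $A^*$ or $B^*$ is selected. If $\partial T=\{x,y\}$ with $x\ne y$, the same process (calling $\mathrm{select}$ only when both children of the current cluster are path children, otherwise descending to the unique path child) ends with a unique edge $(v,w)$ on the path from $x$ to $y$, within the same bounds.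
   Context: Given a tree $T$ and a set $\partial T$ of at most two external boundary vertices, the boundary $\partial C$ of a subtree $C$ is the set of its vertices that are in $\partial T$ or incident to an edge of $T$ not in $C$. A cluster is a subtree with at least one edge and $|\partial C|\le2$. A top tree is a binary tree of clusters whose leaves are the single edges of $T$, whose sibling clusters are edge-disjoint, meet in one vertex and have their union as parent, and whose root is $T$. $\mathrm{join}(A,B)$ creates a new root $A\cup B$ over two neighboring root clusters; $\mathrm{split}(C)$ removes a root $C$ leaving its children as roots. If $|\partial C|=2$, its cluster path is the path between its two boundary vertices; a child $A$ of $C$ is a path child if it shares an edge with the cluster path of $C$. *)

(* Defs.v *)
From mathcomp Require Import all_boot.
From Stdlib Require List Permutation.

Set Implicit Arguments.
Unset Strict Implicit.
Unset Printing Implicit Defensive.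

(* A binary tree of clusters: leaves carry single edges; an edge is a
   2-element vertex set. The cluster of a node is the union of its leaves. *)
Inductive ttree (V : finType) :=
  | Leaf of {set V}
  | Node of ttree V & ttree V.
Arguments Leaf {V} _.
Arguments Node {V} _ _.

Inductive op (V : finType) :=
  | OJoin of ttree V & ttree V
  | OSplit of ttree V.
Arguments OJoin {V} _ _.
Arguments OSplit {V} _.

(* A (deterministic) search strategy: given the address in R of the current
   cluster (the list of directions taken so far, true = left child), the
   join/split operations it performs, and the root cluster on which it then
   calls select (used only when select has to be called). *)
Record search_alg (V : finType) := SearchAlg {
  s_ops : seq bool -> seq (op V);
  s_sel : seq bool -> ttree V }.

Section TopTrees.
Variable V : finType.

Fixpoint edges (t : ttree V) : {set {set V}} :=
  match t with Leaf e => [set e] | Node l r => edges l :|: edges r end.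

Fixpoint height (t : ttree V) : nat :=
  match t with Leaf _ => 0 | Node l r => (maxn (height l) (height r)).+1 end.

Definition verts (C : {set {set V}}) : {set V} := \bigcup_(e in C) e.

Definition adj (C : {set {set V}}) : rel V :=
  fun u v => (u != v) && ([set u; v] \in C).

Definition connected_es (C : {set {set V}}) : Prop :=
  forall u v, u \in verts C -> v \in verts C -> connect (adj C) u v.

Definition acyclic_es (C : {set {set V}}) : Prop :=
  forall p : seq V, ~ [/\ cycle (adj C) p, uniq p & 3 <= size p].

Definition is_tree (C : {set {set V}}) : Prop :=
  [/\ forall e, e \in C -> #|e| = 2, connected_es C & acyclic_es C].

Definition on_path (C : {set {set V}}) (x y : V) (e : {set V}) : Prop :=
  exists p : seq V,
    [/\ path (adj C) x p, last x p = y, uniq (x :: p)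
      & e \in [seq [set a.1; a.2] | a <- zip (x :: p) p]].

Variables (ET : {set {set V}}) (dT : {set V}).

Definition bd (C : {set {set V}}) : {set V} :=
  [set v in verts C | (v \in dT) || [exists e in ET :\: C, v \in e]].

Definition is_subtree (C : {set {set V}}) : Prop :=
  [/\ C \subset ET, C != set0 & is_tree C].

Definition is_cluster (C : {set {set V}}) : Prop :=
  is_subtree C /\ #|bd C| <= 2.

Fixpoint valid_tt (t : ttree V) : Prop :=
  match t with
  | Leaf e => e \in ET /\ is_cluster [set e]
  | Node l r =>
      [/\ valid_tt l, valid_tt r, [disjoint edges l & edges r],
          #|verts (edges l) :&: verts (edges r)| = 1
        & is_cluster (edges l :|: edges r)]
  end.

Definition top_tree (R : ttree V) : Prop :=
  [/\ is_tree ET, dT \subset verts ET, #|dT| <= 2, valid_tt R & edges R = ET].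

Definition join_ok (A B : ttree V) : Prop :=
  #|verts (edges A) :&: verts (edges B)| = 1 /\ is_cluster (edges A :|: edges B).

Definition step (F : seq (ttree V)) (o : op V) (F' : seq (ttree V)) : Prop :=
  match o with
  | OJoin A B => exists rest, [/\ Permutation.Permutation F (A :: B :: rest),
                                 join_ok A B & F' = Node A B :: rest]
  | OSplit X => exists A B rest, [/\ X = Node A B,
                                    Permutation.Permutation F (X :: rest)
                                  & F' = A :: B :: rest]
  end.

Fixpoint exec (os : seq (op V)) (F F' : seq (ttree V)) : Prop :=
  match os with
  | [::] => F = F'
  | o :: os' => exists F1, step F o F1 /\ exec os' F1 F'
  end.

Definition path_child (C A : {set {set V}}) : Prop :=
  exists x y, [/\ x != y, bd C = [set x; y] & exists2 e, e \in A & on_path C x y e].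

Definition needsel (A B : ttree V) : Prop :=
  #|dT| <= 1 \/
  (path_child (edges A :|: edges B) (edges A) /\ path_child (edges A :|: edges B) (edges B)).

Variables (select : ttree V -> bool) (alg : search_alg V).

(* descent C addr F chosen n F' e : starting at current cluster C of R (with
   address addr) and forest F, the search performs n calls (joins, splits and
   selects), the clusters chosen by select are 'chosen', it ends in forest F'
   at the leaf edge e (which is returned). *)
Inductive descent : ttree V -> seq bool -> seq (ttree V) ->
                    seq {set {set V}} -> nat -> seq (ttree V) -> {set V} -> Prop :=
  | d_leaf e addr F F1 :
      exec (s_ops alg addr) F F1 ->
      descent (Leaf e) addr F [::] (size (s_ops alg addr)) F1 e
  | d_sel A B As Bs addr F F1 ch n F2 e :
      exec (s_ops alg addr) F F1 ->
      needsel A B ->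
      s_sel alg addr = Node As Bs ->
      List.In (Node As Bs) F1 ->
      edges A \subset edges As -> edges B \subset edges Bs ->
      edges As :|: edges Bs = ET ->
      descent (if select (Node As Bs) then A else B)
              (rcons addr (select (Node As Bs))) F1 ch n F2 e ->
      descent (Node A B) addr F
              ((if select (Node As Bs) then edges As else edges Bs) :: ch)
              (size (s_ops alg addr) + 1 + n) F2 e
  | d_forcedL A B addr F F1 ch n F2 e :
      exec (s_ops alg addr) F F1 ->
      ~ needsel A B ->
      path_child (edges A :|: edges B) (edges A) ->
      descent A (rcons addr true) F1 ch n F2 e ->
      descent (Node A B) addr F ch (size (s_ops alg addr) + n) F2 e
  | d_forcedR A B addr F F1 ch n F2 e :
      exec (s_ops alg addr) F F1 ->
      ~ needsel A B ->
      ~ path_child (edges A :|: edges B) (edges A) ->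
      path_child (edges A :|: edges B) (edges B) ->
      descent B (rcons addr false) F1 ch n F2 e ->
      descent (Node A B) addr F ch (size (s_ops alg addr) + n) F2 e.

End TopTrees.

(* Main.v *)
(* Throughout the search the part of the tree outside the current cluster C is
   kept as at most two top trees, one for each boundary vertex at which
   something is attached to C. When C splits into children A and B meeting
   in c, the outside consists of a piece attached to A away from c, one
   attached to B away from c, and one attached at c. Joining the first and the
   third to A gives A*, joining the second to B gives B*, and after A or B is
   chosen a bounded number of splits and joins restores the invariant. All the
   joins are legal because an edge set meeting the rest of the tree in the
   single vertex c is a cluster as soon as it contains at most one external
   boundary vertex away from c. This holds for connected sets disjoint from an
   edge separating the two external boundary vertices, and the search keeps
   such an edge in the current cluster: a child of the current cluster is a
   path child exactly when it contains one. Since join and split invert each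
   other, the operations performed can simply be undone in reverse order. *)

Require Import Defs.
From mathcomp Require Import all_boot.
From Stdlib Require List Permutation.

Set Implicit Arguments.
Unset Strict Implicit.
Unset Printing Implicit Defensive.

Import Permutation.

(** * Connectivity and separation in edge sets *)

Section EdgeSets.
Variable V : finType.
Implicit Types (C D X Y : {set {set V}}) (e : {set V}) (x y u v c : V).

Lemma vertsP C v : reflect (exists2 e, e \in C & v \in e) (v \in verts C).
Proof. exact: bigcupP. Qed.

Lemma vertsU C D : verts (C :|: D) = verts C :|: verts D.
Proof. exact: bigcup_setU. Qed.

Lemma adj_sym C : symmetric (adj C).
Proof. by move=> u v; rewrite /adj eq_sym setUC. Qed.

Lemma connect_adj_sym C : connect_sym (adj C).
Proof. exact/sym_connect_sym/adj_sym. Qed.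

Lemma adjS C D : C \subset D -> subrel (adj C) (adj D).
Proof. by move=> /subsetP sCD u v /andP[uv /sCD uvD]; apply/andP. Qed.

Lemma connect_adjS C D x y :
  C \subset D -> connect (adj C) x y -> connect (adj D) x y.
Proof.
move=> sCD; apply: connect_sub => u v uv.
exact/connect1/(adjS sCD uv).
Qed.

Lemma connected_esU C D c :
  connected_es C -> connected_es D -> c \in verts C -> c \in verts D ->
  connected_es (C :|: D).
Proof.
move=> cC cD Cc Dc.
have toc u : u \in verts (C :|: D) -> connect (adj (C :|: D)) u c.
  rewrite vertsU inE => /orP[uC|uD].
    exact: connect_adjS (subsetUl _ _) (cC _ _ uC Cc).
  exact: connect_adjS (subsetUr _ _) (cD _ _ uD Dc).
move=> u v /toc uc /toc vc; apply: connect_trans uc _.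
by rewrite connect_adj_sym.
Qed.

Lemma is_treeS C D : is_tree D -> C \subset D -> connected_es C -> is_tree C.
Proof.
move=> [card2 _ acy] sCD cC; split=> // [e eC|p [cyc up p3]].
  exact: card2 (subsetP sCD _ eC).
by apply: (acy p); split=> //; apply: sub_cycle cyc; apply: adjS.
Qed.

Lemma path_del C e x p :
  path (adj C) x p -> e \notin [seq [set a.1; a.2] | a <- zip (x :: p) p] ->
  path (adj (C :\ e)) x p.
Proof.
elim: p x => //= z p IH x /andP[/andP[xz xzC] pth].
rewrite inE negb_or => /andP[ne ninp]; rewrite IH // andbT.
by rewrite /adj xz !inE eq_sym ne.
Qed.

(** A simple path from [u] to [v] avoiding the edge would close up with it to a cycle; a path of two
    vertices is excluded because it would be the deleted edge itself. *)
Lemma acyclic_separates C u v :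
  acyclic_es C -> u != v -> [set u; v] \in C ->
  ~~ connect (adj (C :\ [set u; v])) u v.
Proof.
move=> acy uv uvC; apply/negP => /connectP[p0 pth0 lst0].
case: (shortenP pth0) lst0 => p pth up _ lst; apply: (acy (u :: p)); split=> //.
  rewrite /= rcons_path -lst (sub_path (adjS (subD1set C [set u; v])) pth) /=.
  by rewrite adj_sym /adj uv.
case: p lst pth {up} => [|w [|? ?]] //= lst; first by rewrite lst eqxx in uv.
by rewrite -lst /adj !inE eqxx andbF.
Qed.

(** Induction along the path. If [e] is its first edge, the remainder never returns to [x], hence
    avoids [e], and linking [x] to [y] without [e] would link the two ends of [e]. Otherwise the
    first edge survives the deletion. *)
Lemma on_path_separates C x y e :
  acyclic_es C -> on_path C x y e -> e \in C /\ ~~ connect (adj (C :\ e)) x y.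
Proof.
move=> acy [p [pth <- up ein]]; elim: p x pth up ein => //= z p IH x.
move=> /andP[/andP[xz xzC] pth] /andP[xNp up].
have [-> _|ne ein] := altP (e =P [set x; z]).
  split=> //; apply: contra (acyclic_separates acy xz xzC) => xy.
  apply: connect_trans xy _; rewrite connect_adj_sym; apply/connectP; exists p => //.
  apply: (@sub_in_path _ [pred w | w != x] (adj C)) pth => [s t /= sx tx|].
    rewrite !inE in sx tx; rewrite /adj !inE => /andP[-> ->]; rewrite !andbT /=.
    apply/eqP => /setP/(_ x); rewrite !inE eqxx /=.
    by rewrite ![x == _]eq_sym (negPf sx) (negPf tx).
  by apply/allP => w wp; apply: contraNneq xNp => <-.
rewrite inE (negPf ne) /= in ein; have [eC nzy] := IH z pth up ein.
split=> //; apply: contra nzy; apply: connect_trans; apply: connect1.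
by rewrite adj_sym /adj xz !inE eq_sym ne.
Qed.

Lemma separates_on_path C x y e :
  connect (adj C) x y -> ~~ connect (adj (C :\ e)) x y -> on_path C x y e.
Proof.
move=> /connectP[p0 pth0 lst0]; case: (shortenP pth0) lst0 => p pth up _ lst nxy.
exists p; split=> //; apply: contraNT nxy => /(path_del pth) pth'.
by apply/connectP; exists p.
Qed.

End EdgeSets.

(** * Edges separating the external boundary vertices *)

Section Separation.
Variables (V : finType) (ET : {set {set V}}) (dT : {set V}).
Implicit Types (C S X Y : {set {set V}}) (e : {set V}) (a b c u v x y : V).
Hypothesis treeET : is_tree ET.
Hypothesis dT2 : #|dT| <= 2.

Definition separates e x y := ~~ connect (adj (ET :\ e)) x y.

(* If dT has at most one vertex, every edge set qualifies. *)
Definition hits S :=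
  [forall x in dT, forall y in dT,
     (x != y) ==> [exists e in S, separates e x y]].

Lemma hitsP S :
  reflect (forall x y, x \in dT -> y \in dT -> x != y ->
             exists2 e, e \in S & separates e x y)
          (hits S).
Proof.
apply: (iffP forall_inP) => [h x y xd yd xy|h x xd].
  by move/forall_inP: (h x xd) => /(_ y yd) /implyP/(_ xy)/exists_inP.
by apply/forall_inP => y yd; apply/implyP => xy; apply/exists_inP/h.
Qed.

Lemma separates_sym e x y : separates e x y = separates e y x.
Proof. by rewrite /separates connect_adj_sym. Qed.

Lemma separatesN X e x y :
  X \subset ET -> connected_es X -> e \notin X -> x \in verts X ->
  y \in verts X -> separates e x y = false.
Proof.
move=> sX cX eX xX yX; apply/negbF; apply: connect_adjS (cX _ _ xX yX).
by rewrite subsetD1 sX.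
Qed.

Lemma hits_small S : #|dT| <= 1 -> hits S.
Proof.
by move=> d1; apply/hitsP => x y xd yd; rewrite (card_le1_eqP d1 x y xd yd) eqxx.
Qed.

Lemma hits_pair S x y :
  x != y -> dT = [set x; y] -> hits S = [exists e in S, separates e x y].
Proof.
move=> xy dE; apply/hitsP/exists_inP => [h|[e eS sxy] a b].
  by apply: h; rewrite ?dE ?set21 ?set22.
rewrite dE !inE => /orP[]/eqP-> /orP[]/eqP->; rewrite ?eqxx // => _;
  by exists e => //; rewrite separates_sym.
Qed.

Lemma hits_dichotomy :
  (#|dT| <= 1) + {xy : V * V | xy.1 != xy.2 & dT = [set xy.1; xy.2]}.
Proof.
have [|d2] := leqP #|dT| 1; first by left.
case: (pickP [pred xy : V * V | (xy.1 != xy.2) && (dT == [set xy.1; xy.2])]).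
  by move=> xy /andP[ne /eqP dE]; right; exists xy.
move=> noxy; exfalso; have /cards2P[x [y [xy dE]]] : #|dT| == 2.
  by rewrite eqn_leq dT2.
by have /= := noxy (x, y); rewrite xy dE eqxx.
Qed.

(** At most one pair of external boundary vertices has to be separated, so a single edge decides.
    This is what guarantees a child to descend to. *)
Lemma hitsU S1 S2 : hits (S1 :|: S2) = hits S1 || hits S2.
Proof.
case: hits_dichotomy => [d1|[[x y] /= xy dE]]; first by rewrite !hits_small.
rewrite !(hits_pair _ xy dE); apply/exists_inP/orP => [[e]|].
  by rewrite inE => /orP[eS|eS] sxy; [left|right]; apply/exists_inP; exists e.
by case=> /exists_inP[e eS sxy]; exists e; rewrite // inE eS ?orbT.
Qed.

Lemma hits_sub S1 S2 : S1 \subset S2 -> hits S1 -> hits S2.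
Proof. by move=> /setUidPr <- h1; rewrite hitsU h1. Qed.

(** Two external boundary vertices in [X] would be separated by an edge of [S], but that edge lies
    outside the connected set [X]. *)
Lemma hits_card S X :
  hits S -> [disjoint S & X] -> X \subset ET -> connected_es X ->
  #|dT :&: verts X| <= 1.
Proof.
move=> /hitsP hS dis sX cX; apply/card_le1_eqP => x y.
rewrite !inE => /andP[xd xX] /andP[yd yX]; apply/eqP/negPn/negP => xy.
have [e eS] := hS y x yd xd xy.
by rewrite (separatesN sX cX) // (disjointFr dis).
Qed.

(** A connected part hanging on the remainder of the tree at [c] only; the inclusion also admits
    [X = ET]. *)
Definition branch c X :=
  [/\ X \subset ET, connected_es X, c \in verts X
    & verts X :&: verts (ET :\: X) \subset [set c]].

Lemma branch_anchor c X v e :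
  branch c X -> v \in verts X -> v \in e -> e \in ET -> e \notin X -> v = c.
Proof.
move=> [_ _ _ /subsetP sub] vX ve eE eX.
apply/set1P/sub; rewrite inE vX; apply/vertsP; exists e => //.
by rewrite inE eX.
Qed.

Lemma branchI c X v Y :
  branch c X -> Y \subset ET -> [disjoint X & Y] -> v \in verts X ->
  v \in verts Y -> v = c.
Proof.
move=> bX sY dis vX /vertsP[e eY ve].
by apply: branch_anchor bX vX ve (subsetP sY e eY) _; rewrite (disjointFl dis).
Qed.

Lemma branchU c X Y :
  branch c X -> branch c Y -> branch c (X :|: Y).
Proof.
move=> bX bY; have [[sX cX Xc _] [sY cY Yc _]] := (bX, bY); split.
- by rewrite subUset sX.
- exact: connected_esU Xc Yc.
- by rewrite vertsU inE Xc.
apply/subsetP => v; rewrite vertsU !inE => /andP[vXY /vertsP[e]].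
rewrite !inE negb_or => /andP[/andP[eX eY] eE] ve.
case/orP: vXY => [vX|vY]; first by rewrite (branch_anchor bX vX ve).
by rewrite (branch_anchor bY vY ve).
Qed.

Lemma bdP C v :
  reflect (v \in verts C /\
           (v \in dT \/ exists2 e, e \in ET :\: C & v \in e))
          (v \in bd ET dT C).
Proof.
rewrite inE; apply: (iffP andP) => -[vC H]; split=> //.
  by case/orP: H => [|/exists_inP[e eE ve]]; [left | right; exists e].
by case: H => [->//|[e eE ve]]; apply/orP; right; apply/exists_inP; exists e.
Qed.

Lemma verts_neq0 C v : v \in verts C -> C != set0.
Proof. by move=> /vertsP[e eC _]; apply/set0Pn; exists e. Qed.

(** The boundary lies in [c] together with the external boundary vertices in [X], of which
    [hits_card] leaves at most one. *)
Lemma branch_cluster S c X :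
  branch c X -> hits S -> [disjoint S & X] -> is_cluster ET dT X.
Proof.
move=> bX hS dis; have [sX cX Xc _] := bX; split.
  by split=> //; [apply: verts_neq0 Xc | apply: is_treeS treeET sX cX].
have sub : bd ET dT X \subset c |: (dT :&: verts X).
  apply/subsetP => v /bdP[vX]; rewrite !inE vX andbT => -[->|[e]].
    by rewrite orbT.
  by rewrite inE => /andP[eX eE] ve; rewrite (branch_anchor bX vX ve) ?eqxx.
apply: leq_trans (subset_leq_card sub) _; rewrite cardsU1.
exact: leq_add (leq_b1 _) (hits_card hS dis sX cX).
Qed.

Lemma top_cluster : ET != set0 -> is_cluster ET dT ET.
Proof.
move=> nz; split=> //; apply: leq_trans dT2; apply: subset_leq_card.
apply/subsetP => v /bdP[_ [//|[e]]]; by rewrite setDv inE.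
Qed.

Lemma on_path_subtreeE C a b e :
  is_subtree ET C -> a \in verts C -> b \in verts C ->
  on_path C a b e <-> e \in C /\ separates e a b.
Proof.
move=> [sC _ [_ cC acyC]] aC bC; have [_ _ acy] := treeET; split=> [pC|[eC sab]].
  have [eC _] := on_path_separates acyC pC; split=> //.
  have [p [pth lst up ein]] := pC.
  suff /(on_path_separates acy)[] : on_path ET a b e by [].
  by exists p; split=> //; apply: sub_path pth; apply: adjS.
apply: separates_on_path (cC _ _ aC bC) _; apply: contra sab.
exact/connect_adjS/setSD.
Qed.

End Separation.

(** * Executing and reversing joins and splits *)

Section Forests.
Variables (V : finType) (ET : {set {set V}}) (dT : {set V}).
Implicit Types (A B t : ttree V) (F G H : seq (ttree V)).

Notation valid := (valid_tt ET dT).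

Lemma valid_cluster t : valid t -> is_cluster ET dT (edges t).
Proof. by case: t => [e []|A B []]. Qed.

Lemma valid_edges t : valid t -> edges t \subset ET.
Proof. by move=> /valid_cluster[[]]. Qed.

Lemma valid_connected t : valid t -> connected_es (edges t).
Proof. by move=> /valid_cluster[[_ _ []]]. Qed.

Lemma valid_join_ok A B : valid (Node A B) -> join_ok ET dT A B.
Proof. by case. Qed.

(** Edge-disjointness follows from the single common vertex, since a common edge would contribute
    two. *)
Lemma join_ok_valid A B :
  valid A -> valid B -> join_ok ET dT A B -> valid (Node A B).
Proof.
move=> vA vB [meet1 clu]; split=> //; apply/pred0P => e /=.
apply: contraTF isT => /andP[eA eB].
have [[_ _ [card2 _ _]] _] := valid_cluster vA.
have : e \subset verts (edges A) :&: verts (edges B).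
  by apply/subsetP => v ve; rewrite inE; apply/andP; split; apply/vertsP; exists e.
by move/subset_leq_card; rewrite meet1 card2.
Qed.

Definition all_valid F := forall t, List.In t F -> valid t.

Lemma all_valid_perm F G : Permutation F G -> all_valid F -> all_valid G.
Proof. by move=> FG vF t /(Permutation_in _ (Permutation_sym FG)) /vF. Qed.

(** [exec] fixes the order of the final list; the closing permutation treats forests as
    multisets. *)
Definition runs (os : seq (op V)) F G :=
  exists2 G', exec ET dT os F G' & Permutation G' G.

Lemma step_perm o F F' G :
  Permutation F F' -> step ET dT F' o G -> step ET dT F o G.
Proof.
by move=> FF'; case: o => [A B [r [p ok ->]]|X [A [B [r [-> p ->]]]]];
  [exists r|exists A, B, r]; split=> //; apply: Permutation_trans FF' p.
Qed.

Lemma runs_nil F G : Permutation F G -> runs [::] F G.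
Proof. by exists F. Qed.

Lemma runs_perm os F F' G :
  Permutation F F' -> runs os F' G -> runs os F G.
Proof.
case: os => [|o os] FF' [G' ex G'G].
  by apply: runs_nil; apply: Permutation_trans FF' _; rewrite ex.
case: ex => F1 [/(step_perm FF') st ex]; exists G' => //; by exists F1.
Qed.

Lemma exec_cat os1 os2 F G H :
  exec ET dT os1 F G -> exec ET dT os2 G H -> exec ET dT (os1 ++ os2) F H.
Proof.
elim: os1 F => [|o os1 IH] F /=; first by move->.
by move=> [F1 [st ex]] ex2; exists F1; split=> //; apply: IH.
Qed.

Lemma runs_cat os1 os2 F G H :
  runs os1 F G -> runs os2 G H -> runs (os1 ++ os2) F H.
Proof.
move=> [G' ex1 p] /(runs_perm p)[H' ex2 q]; exists H' => //.
exact: exec_cat ex1 ex2.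
Qed.

Lemma runs_join A B r F :
  valid (Node A B) -> Permutation F (A :: B :: r) ->
  runs [:: OJoin A B] F (Node A B :: r).
Proof.
move=> /valid_join_ok ok p; exists (Node A B :: r) => //=.
by exists (Node A B :: r); split=> //; exists r.
Qed.

Lemma runs_split A B r F :
  Permutation F (Node A B :: r) -> runs [:: OSplit (Node A B)] F (A :: B :: r).
Proof.
move=> p; exists [:: A, B & r] => //=.
by exists [:: A, B & r]; split=> //; exists A, B, r.
Qed.

(** Undoing a split is a join, whose legality is read off from the validity of the split tree; hence
    validity is propagated as well. *)
Lemma step_reverse o F G :
  all_valid F -> step ET dT F o G ->
  all_valid G /\ exists o', runs [:: o'] G F.
Proof.
move=> vF; case: o => [A B [r [p ok ->]]|X [A [B [r [-> p ->]]]]].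
  have vp := all_valid_perm p vF; split.
    move=> t /= [<-|tr]; last by apply: vp; right; right.
    by apply: join_ok_valid ok; apply: vp; [left|right; left].
  exists (OSplit (Node A B)).
  have [G' ex q] := @runs_split A B r _ (Permutation_refl _).
  by exists G' => //; apply: Permutation_trans q (Permutation_sym p).
have vp := all_valid_perm p vF.
have vAB : valid (Node A B) by apply: vp; left.
split=> [t /= [<-|[<-|tr]]|]; [by case: vAB|by case: vAB|by apply: vp; right|].
exists (OJoin A B); have [G' ex q] := runs_join vAB (Permutation_refl [:: A, B & r]).
by exists G' => //; apply: Permutation_trans q (Permutation_sym p).
Qed.

Lemma exec_reverse os F G :
  all_valid F -> exec ET dT os F G ->
  exists2 os', size os' = size os & runs os' G F.
Proof.
elim: os F => [|o os IH] F vF /=; first by move->; exists [::]; last exact: runs_nil.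
move=> [F1 [st ex]]; have [vF1 [o' ro']] := step_reverse vF st.
have [os' sz ros'] := IH _ vF1 ex.
by exists (os' ++ [:: o']); [rewrite size_cat sz addn1|apply: runs_cat ro'].
Qed.

(** A forest of one tree has no other ordering. *)
Lemma runs_exec1 os F t : runs os F [:: t] -> exec ET dT os F [:: t].
Proof.
by move=> [G ex /Permutation_sym p]; rewrite (Permutation_length_1_inv p) in ex.
Qed.

(** Extracts the sequence to be undone; [n] also counts calls to [select], whence the inequality. *)
Lemma descent_exec (sel : ttree V -> bool) (alg : search_alg V) t s F ch n G e :
  descent ET dT sel alg t s F ch n G e ->
  exists2 os, size os <= n & exec ET dT os F G.
Proof.
elim=> {t s F ch n G e}.
- by move=> e s F G ex; exists (s_ops alg s).
- move=> A B As Bs s F F1 ch n G e ex _ _ _ _ _ _ _ [os sz ex'].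
  exists (s_ops alg s ++ os); last exact: exec_cat ex ex'.
  by rewrite size_cat -addnA leq_add2l add1n leqW.
- move=> A B s F F1 ch n G e ex _ _ _ [os sz ex'].
  by exists (s_ops alg s ++ os); rewrite ?size_cat ?leq_add2l //; apply: exec_cat ex ex'.
move=> A B s F F1 ch n G e ex _ _ _ _ [os sz ex'].
by exists (s_ops alg s ++ os); rewrite ?size_cat ?leq_add2l //; apply: exec_cat ex ex'.
Qed.

End Forests.

(** * The pieces around the current cluster *)

Lemma disjoint_setU (T : finType) (A B C : {set T}) :
  [disjoint A & B] -> [disjoint A & C] -> [disjoint A & B :|: C].
Proof. by rewrite -!setI_eq0 setIUr setU_eq0 => -> ->. Qed.

Section Pieces.
Variables (V : finType) (ET : {set {set V}}) (dT : {set V}).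
Hypothesis treeET : is_tree ET.
Hypothesis dT2 : #|dT| <= 2.
Implicit Types (A B t : ttree V) (p q : V * ttree V) (L : seq (V * ttree V)).
Implicit Types (C : {set {set V}}) (e : {set V}) (c v : V) (oa ob oc : option (V * ttree V)).

Notation valid := (valid_tt ET dT).
Notation hits := (hits ET dT).
Notation branch := (branch ET).

(* L lists the part of the tree outside C, one top tree per vertex at which
   something is attached to C, together with that vertex. *)
Record surrounds C L : Prop := Surrounds {
  piece_valid : forall p, List.In p L -> valid p.2;
  piece_branch : forall p, List.In p L -> branch p.1 (edges p.2);
  piece_anchor : forall p, List.In p L -> p.1 \in verts C;
  piece_disjoint : forall p, List.In p L -> [disjoint C & edges p.2];
  anchors_uniq : List.NoDup [seq p.1 | p <- L];
  pieces_disjoint : forall p q, List.In p L -> List.In q L -> p.1 != q.1 ->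
    [disjoint edges p.2 & edges q.2];
  pieces_cover : forall e, e \in ET ->
    e \in C \/ exists2 p, List.In p L & e \in edges p.2 }.

Lemma surrounds_perm C L L' :
  Permutation L L' -> surrounds C L -> surrounds C L'.
Proof.
move=> pm [vL bL aL dL uL ddL cL].
have inL p : List.In p L' -> List.In p L.
  exact: Permutation_in (Permutation_sym pm).
split=> [p /inL|p /inL|p /inL|p /inL||p q /inL pL /inL qL|e /cL]; auto.
  exact: Permutation_NoDup (Permutation_map _ pm) uL.
by case=> [|[p pL ep]]; [left | right; exists p => //; apply: Permutation_in pm pL].
Qed.

Definition attach t (o : option (V * ttree V)) := if o is Some p then Node t p.2 else t.

Definition attach_ops t (o : option (V * ttree V)) : seq (op V) :=
  if o is Some p then [:: OJoin t p.2] else [::].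

Definition detach_ops t (o : option (V * ttree V)) : seq (op V) :=
  if o is Some p then [:: OSplit (Node t p.2)] else [::].

Lemma edges_attach t o e :
  (e \in edges (attach t o)) =
  (e \in edges t) || (if o is Some p then e \in edges p.2 else false).
Proof. by case: o => [p|] /=; rewrite ?inE ?orbF. Qed.

Lemma branch_valid t p :
  valid t -> valid p.2 -> branch p.1 (edges p.2) -> p.1 \in verts (edges t) ->
  [disjoint edges t & edges p.2] ->
  is_cluster ET dT (edges t :|: edges p.2) -> valid (Node t p.2).
Proof.
move=> vt vp bp pt dis clu; split=> //; have [_ _ pp _] := bp.
rewrite -(cards1 p.1); apply: eq_card => v; rewrite !inE.
apply/andP/eqP => [[vt' vp']|->//]; apply: (branchI bp (valid_edges vt)) vp' vt'.
by rewrite disjoint_sym.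
Qed.

(** The state when a cluster opens into [A] and [B] meeting in [c]: [oa] and [ob] are the pieces
    attached away from [c], [oc] the piece attached at [c], each possibly absent. *)
Record fork A B c oa ob oc : Prop := Fork {
  fork_validA : valid A;
  fork_validB : valid B;
  fork_disjoint : [disjoint edges A & edges B];
  fork_meetA : c \in verts (edges A);
  fork_meetB : c \in verts (edges B);
  fork_meet : forall v, v \in verts (edges A) -> v \in verts (edges B) -> v = c;
  fork_anchorA : forall p, oa = Some p -> p.1 \in verts (edges A) /\ p.1 != c;
  fork_anchorB : forall p, ob = Some p -> p.1 \in verts (edges B) /\ p.1 != c;
  fork_anchorC : forall p, oc = Some p -> p.1 = c;
  fork_surrounds : surrounds (edges A :|: edges B)
                     (seq_of_opt oa ++ seq_of_opt ob ++ seq_of_opt oc) }.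

Lemma fork_sym A B c oa ob oc : fork A B c oa ob oc -> fork B A c ob oa oc.
Proof.
case=> vA vB dis cA cB meet aA aB aC sur; split=> //.
- by rewrite disjoint_sym.
- by move=> v vB' vA'; apply: meet.
rewrite setUC; apply: surrounds_perm sur; rewrite !catA.
exact/Permutation_app_tail/Permutation_app_comm.
Qed.

(** * Assembling the pieces on the two sides of a fork *)

Section Fork.
Variables (A B : ttree V) (c : V) (oa ob oc : option (V * ttree V)).
Hypothesis fAB : fork A B c oa ob oc.

Let pieces := seq_of_opt oa ++ seq_of_opt ob ++ seq_of_opt oc.

Let in_oa p : oa = Some p -> List.In p pieces.
Proof. by rewrite /pieces => ->; left. Qed.

Let in_ob p : ob = Some p -> List.In p pieces.
Proof. by rewrite /pieces => ->; apply/List.in_or_app; right; left. Qed.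

Let in_oc p : oc = Some p -> List.In p pieces.
Proof.
by rewrite /pieces => ->; apply/List.in_or_app; right; apply/List.in_or_app; right; left.
Qed.

Let piecesP p : List.In p pieces -> [\/ oa = Some p, ob = Some p | oc = Some p].
Proof.
have optP o q : List.In q (seq_of_opt o) -> o = Some q.
  by case: o => [r|] //= [->|].
move=> pL; have [/optP|pbc] := List.in_app_or _ _ _ pL; first by constructor.
by have [/optP|/optP] := List.in_app_or _ _ _ pbc; constructor.
Qed.

Let sur := fork_surrounds fAB.

Let piece_disjointA p : List.In p pieces -> [disjoint edges A & edges p.2].
Proof.
by move=> /(piece_disjoint sur); apply: disjointWl; apply: subsetUl.
Qed.

Let piece_disjointB p : List.In p pieces -> [disjoint edges B & edges p.2].
Proof.
by move=> /(piece_disjoint sur); apply: disjointWl; apply: subsetUr.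
Qed.

Let disjoint_ab p q : oa = Some p -> ob = Some q -> [disjoint edges p.2 & edges q.2].
Proof.
move=> pa qb; have [pA pc] := fork_anchorA fAB pa; have [qB qc] := fork_anchorB fAB qb.
apply: (pieces_disjoint sur (in_oa pa) (in_ob qb)).
by apply: contraNneq pc => pq; apply/eqP/(fork_meet fAB); rewrite // pq.
Qed.

Let disjoint_ac p q : oa = Some p -> oc = Some q -> [disjoint edges p.2 & edges q.2].
Proof.
move=> pa qc; have [_ pc] := fork_anchorA fAB pa.
apply: (pieces_disjoint sur (in_oa pa) (in_oc qc)).
by rewrite (fork_anchorC fAB qc).
Qed.

Let disjoint_bc p q : ob = Some p -> oc = Some q -> [disjoint edges p.2 & edges q.2].
Proof.
move=> pb qc; have [_ pc] := fork_anchorB fAB pb.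
apply: (pieces_disjoint sur (in_ob pb) (in_oc qc)).
by rewrite (fork_anchorC fAB qc).
Qed.

Let disjoint_A_Bb : [disjoint edges A & edges (attach B ob)].
Proof.
case E: ob => [p|] /=; last exact: fork_disjoint fAB.
exact: disjoint_setU (fork_disjoint fAB) (piece_disjointA (in_ob E)).
Qed.

Let disjoint_A_Bbc : [disjoint edges A & edges (attach (attach B ob) oc)].
Proof.
case E: oc => [p|] /=; last exact: disjoint_A_Bb.
exact: disjoint_setU disjoint_A_Bb (piece_disjointA (in_oc E)).
Qed.

(** An edge outside [B] and its piece lies in [A], in the piece of [A] or in the piece at [c], each
    of which meets [B] in at most [c]; the piece of [B] meets other edges only at its anchor, a
    vertex of [B]. *)
Lemma fork_branch : branch c (edges (attach B ob)).
Proof.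
have sB := valid_edges (fork_validB fAB); have cB := valid_connected (fork_validB fAB).
have out v e : v \in verts (edges B) -> v \in e -> e \in ET -> e \notin edges B ->
    (forall p, ob = Some p -> e \notin edges p.2) -> v = c.
  move=> vB ve eE eB eb; case: (pieces_cover sur eE) => [|[p pL ep]].
    rewrite inE (negPf eB) orbF => eA; apply: (fork_meet fAB) vB.
    by apply/vertsP; exists e.
  have vp : v = p.1.
    apply: (branchI (piece_branch sur pL) sB) vB.
      by rewrite disjoint_sym piece_disjointB.
    by apply/vertsP; exists e.
  case: (piecesP pL) => [pa|pb|pc].
  - by apply: (fork_meet fAB) vB; rewrite vp; case: (fork_anchorA fAB pa).
  - by have := eb p pb; rewrite ep.
  - by rewrite vp (fork_anchorC fAB pc).
case E: ob => [p|] /=; last first.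
  split=> //; first exact: fork_meetB fAB.
  apply/subsetP => v; rewrite !inE => /andP[vB /vertsP[e]].
  by rewrite inE => /andP[eB eE] ve; apply/eqP/(out v e) => // p; rewrite E.
have pL := in_ob E; have bp := piece_branch sur pL; have [sp cp pp _] := bp.
have [pB _] := fork_anchorB fAB E; split.
- by rewrite subUset sB.
- exact: connected_esU pB pp.
- by rewrite vertsU inE (fork_meetB fAB).
apply/subsetP => v; rewrite vertsU !inE => /andP[vBp /vertsP[e]].
rewrite !inE negb_or => /andP[/andP[eB ep] eE] ve; apply/eqP.
have vB : v \in verts (edges B).
  by case/orP: vBp => // vp; rewrite (branch_anchor bp vp ve).
by apply: (out v e) => // q; rewrite E => -[<-].
Qed.

Lemma fork_branch_rest : branch c (edges (attach (attach B ob) oc)).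
Proof.
case E: oc => [p|] /=; last exact: fork_branch.
apply: branchU fork_branch _; rewrite -(fork_anchorC fAB E).
exact: piece_branch sur _ (in_oc E).
Qed.

(** The set [edges A] hits and is disjoint from this branch at [c], so [branch_cluster] makes the
    join legal. *)
Lemma fork_valid : hits (edges A) -> valid (attach B ob).
Proof.
move=> hA; have clu := branch_cluster treeET fork_branch hA disjoint_A_Bb.
have vB := fork_validB fAB; case E: ob => [p|] //; rewrite E in clu.
have pL := in_ob E; apply: branch_valid => //.
- exact: piece_valid sur _ pL.
- exact: piece_branch sur _ pL.
- by case: (fork_anchorB fAB E).
exact: piece_disjointB.
Qed.

Lemma fork_valid_rest : hits (edges A) -> valid (attach (attach B ob) oc).
Proof.
move=> hA; have vB := fork_valid hA.
have clu := branch_cluster treeET fork_branch_rest hA disjoint_A_Bbc.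
case E: oc => [p|] //; rewrite E in clu.
have pL := in_oc E; apply: branch_valid => //.
- exact: piece_valid sur _ pL.
- exact: piece_branch sur _ pL.
- by rewrite (fork_anchorC fAB E); case: fork_branch.
case E': ob => [q|] /=; last exact: piece_disjointB.
rewrite disjoint_sym; apply: disjoint_setU; rewrite disjoint_sym.
  exact: piece_disjointB.
exact: disjoint_bc E' E.
Qed.

(** The invariant after descending to [A]: [B] with its piece and the piece at [c] become one piece
    anchored at [c], beside the old piece [oa]. *)
Lemma fork_child :
  hits (edges A) ->
  surrounds (edges A) (rcons (seq_of_opt oa) (c, attach (attach B ob) oc)).
Proof.
move=> hA; have inP p : 
      List.In p (rcons (seq_of_opt oa) (c, attach (attach B ob) oc)) ->
    oa = Some p \/ p = (c, attach (attach B ob) oc).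
  by case: (oa) => [q|] /= [->|] //; [left|case=> // ->; right|right].
have dis p : oa = Some p -> [disjoint edges p.2 & edges (attach (attach B ob) oc)].
  move=> pa; apply/pred0P => e /=; apply/negP => /andP[ep].
  rewrite !edges_attach -orbA => /or3P[eB||].
  - by have := disjointFr (piece_disjointB (in_oa pa)) eB; rewrite ep.
  - by case E: ob => [q|] //; rewrite (disjointFr (disjoint_ab pa E) ep).
  - by case E: oc => [q|] //; rewrite (disjointFr (disjoint_ac pa E) ep).
split.
- by move=> p /inP[/in_oa/(piece_valid sur)//|->]; apply: fork_valid_rest.
- by move=> p /inP[/in_oa/(piece_branch sur)//|->]; apply: fork_branch_rest.
- by move=> p /inP[/(fork_anchorA fAB)[]//|->]; apply: fork_meetA fAB.
- by move=> p /inP[/in_oa/piece_disjointA//|->].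
- case E: oa => [p|] /=; last by constructor=> //; constructor.
  constructor; last by constructor=> //; constructor.
  by case: (fork_anchorA fAB E) => _ /eqP pc [cp|//]; apply: pc.
- move=> p q /inP[pa|->] /inP[qa|->]; rewrite ?eqxx //=.
  + by move: qa; rewrite pa => -[->]; rewrite eqxx.
  + by move=> _; apply: dis.
  + by move=> _; rewrite disjoint_sym dis.
move=> e eE; case: (pieces_cover sur eE) => [|[p pL ep]].
  rewrite inE => /orP[|eB]; [by left|right].
  exists (c, attach (attach B ob) oc); last by rewrite !edges_attach eB.
  by case: (oa) => [q|] /=; [right; left|left].
right; case: (piecesP pL) => [pa|pb|pc].
- by exists p => //; rewrite pa; left.
- exists (c, attach (attach B ob) oc); last by rewrite !edges_attach pb ep orbT.
  by case: (oa) => [q|] /=; [right; left|left].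
exists (c, attach (attach B ob) oc); last by rewrite !edges_attach pc ep orbT.
by case: (oa) => [q|] /=; [right; left|left].
Qed.

Lemma fork_sides_disjoint :
  [disjoint edges (attach (attach A oa) oc) & edges (attach B ob)].
Proof.
apply/pred0P => e /=; apply/negP; rewrite !edges_attach -orbA.
case/andP => /or3P[eA|ea|ec] /orP[eB|eb].
- by rewrite (disjointFr (fork_disjoint fAB) eA) in eB.
- case E: ob eb => [q|] // eb.
  by rewrite (disjointFr (piece_disjointA (in_ob E)) eA) in eb.
- case E: oa ea => [q|] // ea.
  by rewrite (disjointFr (piece_disjointB (in_oa E)) eB) in ea.
- case E: oa ea => [p|] // ea; case E': ob eb => [q|] // eb.
  by rewrite (disjointFr (disjoint_ab E E') ea) in eb.
- case E: oc ec => [q|] // ec.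
  by rewrite (disjointFr (piece_disjointB (in_oc E)) eB) in ec.
case E: oc ec => [p|] // ec; case E': ob eb => [q|] // eb.
by rewrite (disjointFr (disjoint_bc E' E) eb) in ec.
Qed.

Lemma fork_cover :
  edges (attach (attach A oa) oc) :|: edges (attach B ob) \subset ET ->
  edges (attach (attach A oa) oc) :|: edges (attach B ob) = ET.
Proof.
move=> sub; apply/eqP; rewrite eqEsubset sub; apply/subsetP => e eE.
rewrite inE !edges_attach; case: (pieces_cover sur eE) => [|[p pL ep]].
  by rewrite inE => /orP[]->; rewrite ?orbT.
by case: (piecesP pL) => ->; rewrite ep ?orbT.
Qed.

End Fork.

(** Both children must hit because the legality of either side rests on the other child. The final
    join is legal since its cluster is all of [ET], with boundary inside [dT]. *)
Lemma fork_top A B c oa ob oc :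
  fork A B c oa ob oc -> hits (edges A) -> hits (edges B) ->
  valid (Node (attach (attach A oa) oc) (attach B ob)) /\
  edges (attach (attach A oa) oc) :|: edges (attach B ob) = ET.
Proof.
move=> f hA hB; have f' := fork_sym f.
have vA := fork_valid_rest f' hB; have vB := fork_valid f hA.
have := fork_cover f; rewrite subUset (valid_edges vA) (valid_edges vB) => /(_ isT) cover.
have bA := fork_branch_rest f'; have [_ _ cA _] := bA.
have [_ _ cB _] := fork_branch f; split=> //.
apply: join_ok_valid => //; split.
  rewrite -(cards1 c); apply: eq_card => v; rewrite !inE.
  apply/andP/eqP => [[vA' vB']|-> //].
  exact: branchI bA (valid_edges vB) (fork_sides_disjoint f) vA' vB'.
rewrite cover; apply: top_cluster => //.
by case/vertsP: cA => e eA _; apply/set0Pn; exists e; apply: (subsetP (valid_edges vA)).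
Qed.

Lemma surrounds_bd C p L :
  surrounds C L -> List.In p L -> p.1 \in bd ET dT C.
Proof.
move=> sur pL; apply/bdP; split; first exact: piece_anchor sur _ pL.
right; have [/subsetP sp _ /vertsP[e ep pe] _] := piece_branch sur pL.
by exists e => //; rewrite inE (sp _ ep) (disjointFl (piece_disjoint sur pL) ep).
Qed.

(* A child of a cluster carries its meeting vertex with the sibling as a
   boundary vertex, hence has room for one further anchor only. *)
Lemma anchors_le1 A B c L p q :
  valid A -> edges B \subset ET -> [disjoint edges A & edges B] ->
  c \in verts (edges A) -> c \in verts (edges B) ->
  surrounds (edges A :|: edges B) L -> List.In p L -> List.In q L ->
  p.1 \in verts (edges A) -> q.1 \in verts (edges A) ->
  p.1 != c -> q.1 != c -> p.1 = q.1.
Proof.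
move=> vA sB dis cA cB sur pL qL pA qA pc qc; apply/eqP/negPn/negP => pq.
have inbd r : List.In r L -> r.1 \in verts (edges A) -> r.1 \in bd ET dT (edges A).
  move=> rL rA; apply/bdP; split=> //.
  have /bdP[_ [rd|[e H re]]] := surrounds_bd sur rL; [by left|right].
  by move: H; rewrite !inE negb_or => /andP[/andP[eA _] eE]; exists e; rewrite // inE eA.
have cbd : c \in bd ET dT (edges A).
  apply/bdP; split=> //; right; case/vertsP: cB => e eB ce.
  by exists e; rewrite // inE (disjointFl dis eB) (subsetP sB).
have [_ ] := valid_cluster vA; apply/negP; rewrite -ltnNge.
have -> : 3 = #|c |: [set p.1; q.1]|.
  by rewrite cardsU1 cards2 pq !inE ![c == _]eq_sym (negPf pc) (negPf qc).
apply: subset_leq_card; by apply/subsetP => v /setU1P[->|/set2P[]->] //; apply: inbd.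
Qed.

(** The pieces are sorted by anchor: at [c], in [A] away from [c], or in [B] away from [c]. *)
Lemma fork_exists A B L :
  valid (Node A B) -> surrounds (edges A :|: edges B) L ->
  exists c oa ob oc,
    Permutation L (seq_of_opt oa ++ seq_of_opt ob ++ seq_of_opt oc) /\
    fork A B c oa ob oc.
Proof.
move=> [vA vB dis /eqP/cards1P[c meet] _] sur.
have meetE v : (v \in verts (edges A)) && (v \in verts (edges B)) = (v == c).
  by rewrite -in_setI meet inE.
have /andP[cA cB] : (c \in verts (edges A)) && (c \in verts (edges B)).
  by rewrite meetE.
have [la [lb [lc [pm inA inB inC]]]] : exists la lb lc,
    [/\ Permutation L (la ++ lb ++ lc),
      forall p, List.In p la -> p.1 \in verts (edges A) /\ p.1 != c,
      forall p, List.In p lb -> p.1 \in verts (edges B) /\ p.1 != c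
    & forall p, List.In p lc -> p.1 = c].
  elim: L {sur} (piece_anchor sur) => [|p L IH] anc.
    by exists [::], [::], [::]; split.
  have [|la [lb [lc [pm inA inB inC]]]] := IH; first by move=> q qL; apply: anc; right.
  have := anc p (or_introl erefl); rewrite vertsU inE.
  have [pc _|pc] := eqVneq p.1 c.
    exists la, lb, (p :: lc); split=> // [|q /= [<-|/inC]] //.
    by rewrite !catA in pm *; apply: Permutation_cons_app pm.
  case/orP => pAB.
    exists (p :: la), lb, lc; split=> // [|q /= [<-|/inA]] //.
    exact: perm_skip.
  exists la, (p :: lb), lc; split=> // [|q /= [<-|/inB]] //.
  exact: Permutation_cons_app.
have sur' := surrounds_perm pm sur; have := anchors_uniq sur'; rewrite !map_cat => nd.
(* Each class has at most one piece: its anchors coincide, by [anchors_le1] or by being [c], while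
   anchors of different pieces are distinct. *)
have le1 (l : seq (V * ttree V)) : List.NoDup [seq p.1 | p <- l] ->
    (forall p q, List.In p l -> List.In q l -> p.1 = q.1) ->
    exists o, l = seq_of_opt o.
  case: l => [|p [|q l]] ndl eql; [by exists None|by exists (Some p)|].
  have pq := eql p q (or_introl erefl) (or_intror (or_introl erefl)).
  by move/List.NoDup_cons_iff: ndl => [[]]; left.
have [oa oaE] : exists o, la = seq_of_opt o.
  apply: le1; first exact: List.NoDup_app_remove_r nd.
  move=> p q pL qL; have [[pA pc] [qA qc]] := (inA p pL, inA q qL).
  by apply: (anchors_le1 vA (valid_edges vB) dis cA cB sur'); rewrite //;
    apply/List.in_or_app; left.
have [ob obE] : exists o, lb = seq_of_opt o.
  apply: le1; first exact: List.NoDup_app_remove_r (List.NoDup_app_remove_l _ _ nd).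
  move=> p q pL qL; have [[pB pc] [qB qc]] := (inB p pL, inB q qL).
  rewrite setUC in sur'; rewrite disjoint_sym in dis.
  by apply: (anchors_le1 vB (valid_edges vA) dis cB cA sur'); rewrite //;
    apply/List.in_or_app; right; apply/List.in_or_app; left.
have [oc ocE] : exists o, lc = seq_of_opt o.
  apply: le1; last by move=> p q /inC-> /inC->.
  exact: List.NoDup_app_remove_l (List.NoDup_app_remove_l _ _ nd).
exists c, oa, ob, oc; rewrite -oaE -obE -ocE; split=> //; split=> //.
- by move=> v vA' vB'; apply/eqP; rewrite -meetE vA'.
- by move=> p E; apply: inA; rewrite oaE E; left.
- by move=> p E; apply: inB; rewrite obE E; left.
- by move=> p E; apply: inC; rewrite ocE E; left.
by rewrite -oaE -obE -ocE.
Qed.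

End Pieces.

(** * The search *)

(** Cancels equal heads, and otherwise rotates the right-hand list by one position. *)
Ltac solve_perm :=
  cbn; repeat first
    [ exact: Permutation_refl
    | apply: perm_skip
    | eapply Permutation_trans;
        [| exact: (Permutation_sym (Permutation_cons_append _ _))]; cbn ].

Section Search.
Variables (V : finType) (ET : {set {set V}}) (dT : {set V}).
Hypothesis treeET : is_tree ET.
Hypothesis dT2 : #|dT| <= 2.
Hypothesis dTsub : dT \subset verts ET.
Implicit Types (A B t : ttree V) (p q : V * ttree V) (L : seq (V * ttree V)).
Implicit Types (C S : {set {set V}}) (e : {set V}) (a b c v x y : V).
Implicit Types (oa ob oc : option (V * ttree V)) (F G : seq (ttree V)).

Notation valid := (valid_tt ET dT).
Notation hits := (hits ET dT).
Notation separates := (separates ET).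
Notation runs := (runs ET dT).
Notation trees L := [seq p.2 | p <- L].

(** The vertex [a] is where [x] enters [C]: [x] itself if it lies in [C], otherwise the anchor of a
    piece containing it, reached inside that piece and hence without edges of [C]. *)
Lemma boundary_gate C L x :
  surrounds ET dT C L -> x \in dT ->
  exists2 a, a \in bd ET dT C &
    forall e, e \in C -> connect (adj (ET :\ e)) x a.
Proof.
move=> sur xd; have [xC|xC] := boolP (x \in verts C).
  by exists x => //; apply/bdP; split=> //; left.
have /vertsP[f fE xf] := subsetP dTsub x xd.
case: (pieces_cover sur fE) => [fC|[p pL fp]].
  by case/negP: xC; apply/vertsP; exists f.
exists p.1 => [|e eC]; first exact: surrounds_bd sur pL.
have [sp cp pp _] := piece_branch sur pL.
apply/negPn; rewrite -/(separates e x p.1) (separatesN sp cp) //.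
  by rewrite (disjointFr (piece_disjoint sur pL) eC).
by apply/vertsP; exists f.
Qed.

(** The external boundary vertices enter [C] at [a] and [b], and an edge of [C] separates the former
    exactly when it separates the latter. Since [C] hits, [a] and [b] differ, so they exhaust the
    boundary and the cluster path runs between them. *)
Lemma path_childE C L S :
  is_cluster ET dT C -> surrounds ET dT C L -> 1 < #|dT| -> hits C ->
  S \subset C -> path_child ET dT C S <-> hits S.
Proof.
move=> [subC bd2] sur d2 hC sSC.
have [|[[x y] /= xy dE]] := hits_dichotomy dT2; first by rewrite leqNgt d2.
have [a abd xa] : exists2 a, a \in bd ET dT C &
    forall e, e \in C -> connect (adj (ET :\ e)) x a.
  by apply: boundary_gate sur _; rewrite dE set21.
have [b bbd yb] : exists2 b, b \in bd ET dT C &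
    forall e, e \in C -> connect (adj (ET :\ e)) y b.
  by apply: boundary_gate sur _; rewrite dE set22.
have sepE e : e \in C -> separates e x y = separates e a b.
  move=> eC; rewrite /separates (same_connect (connect_adj_sym _) (xa e eC)).
  by rewrite (same_connect_r (connect_adj_sym _) (yb e eC)).
have ab : a != b.
  move: hC; rewrite (hits_pair _ _ xy dE) => /exists_inP[e eC]; rewrite sepE //.
  by apply: contraNneq => ->; apply: connect0.
have bdE : bd ET dT C = [set a; b].
  apply/esym/eqP; rewrite eqEcard cards2 ab bd2 andbT.
  by apply/subsetP => z /set2P[]->.
have [/bdP[aC _] /bdP[bC _]] := (abd, bbd).
have pathE := on_path_subtreeE treeET _ subC.
rewrite (hits_pair _ _ xy dE); split=> [[a' [b' [ab' bdE' [e eS pe]]]]|].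
  have [/bdP[aC' _] /bdP[bC' _]] : a' \in bd ET dT C /\ b' \in bd ET dT C.
    by rewrite bdE' set21 set22.
  have [eC sep'] := (pathE a' b' e aC' bC').1 pe.
  apply/exists_inP; exists e; rewrite // sepE //.
  have /set2P aE : a \in [set a'; b'] by rewrite -bdE'.
  have /set2P bE : b \in [set a'; b'] by rewrite -bdE'.
  case: aE bE ab => -> [->|->]; rewrite ?eqxx // => _.
  by rewrite separates_sym.
move=> /exists_inP[e eS sxy]; have eC := subsetP sSC _ eS.
exists a, b; split=> //; exists e => //; apply/(pathE a b e aC bC).
by rewrite -sepE.
Qed.

Lemma runs_cons_split A B r F os G :
  Permutation F (Node A B :: r) -> runs os (A :: B :: r) G ->
  runs (OSplit (Node A B) :: os) F G.
Proof. by move=> p; apply: (runs_cat (os1 := [:: _]) (runs_split ET dT p)). Qed.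

Lemma runs_attach t o r F os G :
  valid (attach t o) -> Permutation F (t :: trees (seq_of_opt o) ++ r) ->
  runs os (attach t o :: r) G -> runs (attach_ops t o ++ os) F G.
Proof.
case: o => [p|] v pm; last exact: runs_perm.
exact: runs_cat (runs_join v pm).
Qed.

Lemma runs_detach t o r F os G :
  Permutation F (attach t o :: r) ->
  runs os (t :: trees (seq_of_opt o) ++ r) G ->
  runs (detach_ops t o ++ os) F G.
Proof.
case: o => [p|] pm; last exact: runs_perm.
exact: runs_cat (runs_split ET dT pm).
Qed.

(** * Operation sequences for one step of the search *)

Section Moves.
Variables (A B : ttree V) (c : V) (oa ob oc : option (V * ttree V)).
Hypothesis fAB : fork ET dT A B c oa ob oc.

Let sideA := attach (attach A oa) oc.
Let sideB := attach B ob.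

Definition open_ops : seq (op V) :=
  OSplit (Node A B) :: attach_ops A oa ++ attach_ops (attach A oa) oc ++
  attach_ops B ob ++ [:: OJoin sideA sideB].

Lemma runs_open F :
  hits (edges A) -> hits (edges B) ->
  Permutation F (Node A B :: trees (seq_of_opt oa ++ seq_of_opt ob ++ seq_of_opt oc)) ->
  runs open_ops F [:: Node sideA sideB].
Proof.
move=> hA hB pm; have [top _] := fork_top treeET dT2 fAB hA hB.
have fBA := fork_sym fAB.
apply: runs_cons_split pm _.
apply: (runs_attach (r := B :: trees (seq_of_opt ob ++ seq_of_opt oc))).
- exact: (fork_valid treeET fBA).
- by rewrite !map_cat; case: (oa) (ob) (oc) => [?|] [?|] [?|]; solve_perm.
apply: (runs_attach (r := B :: trees (seq_of_opt ob))).
- exact: (fork_valid_rest treeET fBA).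
- by rewrite !map_cat; case: (ob) (oc) => [?|] [?|]; solve_perm.
apply: (runs_attach (r := [:: sideA])).
- exact: (fork_valid treeET fAB).
- by case: (ob) => [?|]; solve_perm.
by apply: runs_join => //; solve_perm.
Qed.

(** The piece at [c] was placed on the side of [A] and has to move over to [B]. *)
Definition chooseA_ops : seq (op V) :=
  OSplit (Node sideA sideB) :: detach_ops (attach A oa) oc ++
  detach_ops A oa ++ attach_ops sideB oc ++ [::].

Lemma runs_chooseA :
  hits (edges A) ->
  runs chooseA_ops [:: Node sideA sideB]
    (A :: trees (rcons (seq_of_opt oa) (c, attach sideB oc))).
Proof.
move=> hA; apply: runs_cons_split (Permutation_refl _) _.
apply: runs_detach (Permutation_refl _) _.
apply: (runs_detach (r := trees (seq_of_opt oc) ++ [:: sideB])) (Permutation_refl _) _.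
apply: (runs_attach (r := A :: trees (seq_of_opt oa))).
- exact: (fork_valid_rest treeET fAB).
- by case: (oa) (oc) => [?|] [?|]; solve_perm.
by apply: runs_nil; rewrite map_rcons; case: (oa) => [?|]; solve_perm.
Qed.

(** Here [sideA] already contains the piece at [c] and serves as the new piece unchanged. *)
Definition chooseB_ops : seq (op V) :=
  OSplit (Node sideA sideB) :: detach_ops B ob ++ [::].

Lemma runs_chooseB :
  runs chooseB_ops [:: Node sideA sideB]
    (B :: trees (rcons (seq_of_opt ob) (c, sideA))).
Proof.
apply: runs_cons_split (Permutation_refl _) _.
apply: (runs_detach (r := [:: sideA])); first by solve_perm.
by apply: runs_nil; rewrite map_rcons; case: (ob) => [?|]; solve_perm.
Qed.

(** Builds the new outside piece without first forming a root over [ET], so that it is enough for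
    [A] to hit. *)
Definition force_ops : seq (op V) :=
  attach_ops B ob ++ attach_ops sideB oc ++ [::].

Lemma runs_force F :
  hits (edges A) ->
  Permutation F
    (A :: B :: trees (seq_of_opt oa ++ seq_of_opt ob ++ seq_of_opt oc)) ->
  runs force_ops F (A :: trees (rcons (seq_of_opt oa) (c, attach sideB oc))).
Proof.
move=> hA pm.
apply: (runs_attach (r := A :: trees (seq_of_opt oa ++ seq_of_opt oc))).
- exact: (fork_valid treeET fAB).
- apply: Permutation_trans pm _; rewrite !map_cat.
  by case: (oa) (ob) (oc) => [?|] [?|] [?|]; solve_perm.
apply: (runs_attach (r := A :: trees (seq_of_opt oa))).
- exact: (fork_valid_rest treeET fAB).
- by rewrite !map_cat; case: (oa) (oc) => [?|] [?|]; solve_perm.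
by apply: runs_nil; rewrite map_rcons; case: (oa) => [?|]; solve_perm.
Qed.

End Moves.

(* The strategy is indexed relative to the current cluster, so that strategies
   for the two children can be glued into one for the parent. *)
Definition searchable t F :=
  exists alg : search_alg V,
  forall (s : seq bool) (alg' : search_alg V),
    (forall s', s_ops alg' (s ++ s') = s_ops alg s') ->
    (forall s', s_sel alg' (s ++ s') = s_sel alg s') ->
  forall select, exists ch n G e,
  [/\ descent ET dT select alg' t s F ch n G e,
      n <= 10 * (height t).+1,
      e \in edges t /\ hits [set e],
      forall X, X \in ch -> e \in X
    & forall e', e' \in edges t -> hits [set e'] ->
        (forall X, X \in ch -> e' \in X) -> e' = e].

(** The search stops at once; operations still pending from the step above are dropped. *)
Lemma searchable_leaf e F : hits [set e] -> searchable (Leaf e) F.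
Proof.
move=> he; exists (SearchAlg (fun _ => [::]) (fun _ => Leaf e)) => s alg opsE _ sel.
have ops0 : s_ops alg s = [::] by rewrite -[s]cats0 opsE.
exists [::], (size (s_ops alg s)), F, e; split=> //=.
- by apply: d_leaf; rewrite ops0.
- by rewrite ops0.
- by rewrite inE eqxx.
by move=> e' /set1P.
Qed.

Lemma not_hits S e : ~~ hits S -> hits [set e] -> e \notin S.
Proof. by move=> nS he; apply: contra nS; rewrite -sub1set => /hits_sub-> //. Qed.

(** The operations [os] are left pending by the step above: what follows a call to [select] depends
    on its answer and runs only at the child's address. One level costs at most 4 pending
    operations, 5 to open the fork and one [select], which gives the constant 10. *)
Lemma searchable_node A B L F os :
  valid (Node A B) -> surrounds ET dT (edges A :|: edges B) L ->
  hits (edges A :|: edges B) -> size os <= 4 ->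
  runs os F (Node A B :: trees L) ->
  (forall F1 os1 L1, surrounds ET dT (edges A) L1 -> hits (edges A) ->
     size os1 <= 4 -> runs os1 F1 (A :: trees L1) -> searchable A F1) ->
  (forall F1 os1 L1, surrounds ET dT (edges B) L1 -> hits (edges B) ->
     size os1 <= 4 -> runs os1 F1 (B :: trees L1) -> searchable B F1) ->
  searchable (Node A B) F.
Proof.
move=> vAB sur hAB os4 ros IHA IHB.
have [c [oa [ob [oc [pm f]]]]] := fork_exists vAB sur.
have f' := fork_sym f; have clu := valid_cluster vAB.
have pcA := path_childE clu sur _ hAB (subsetUl _ _).
have pcB := path_childE clu sur _ hAB (subsetUr _ _).
have {}pm := Permutation_map snd pm.
have [/andP[hA hB]|nboth] := boolP (hits (edges A) && hits (edges B)).
  have ns : needsel ET dT A B.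
    by case: (leqP #|dT| 1) => [|d2]; [left|right; split; [apply/pcA|apply/pcB]].
  set As := attach (attach A oa) oc; set Bs := attach B ob.
  have [vtop cover] := fork_top treeET dT2 f hA hB.
  have [F1 ex1 pm1] : runs (os ++ open_ops A B oa ob oc) F [:: Node As Bs].
    by apply: runs_cat ros _; apply: (runs_open f) => //; apply: perm_skip.
  have [algA HA] : searchable A F1.
    apply: (IHA F1 (chooseA_ops A B oa ob oc)) (fork_child treeET f hA) (hA) _ _.
      by rewrite /= !size_cat; case: (oa) (oc) => [?|] [?|].
    exact: runs_perm pm1 (runs_chooseA f hA).
  have [algB HB] : searchable B F1.
    apply: (IHB F1 (chooseB_ops A B oa ob oc)) (fork_child treeET f' hB) (hB) _ _.
      by rewrite /= !size_cat; case: (ob) => [?|].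
    exact: runs_perm pm1 (runs_chooseB A B c oa ob oc).
  (* Both strategies start from the same forest [F1], so they can be combined before [select] is
     known; the first direction of the address tells which one applies. *)
  exists (SearchAlg
    (fun s => match s with [::] => os ++ open_ops A B oa ob oc
              | true :: s' => s_ops algA s' | false :: s' => s_ops algB s' end)
    (fun s => match s with [::] => Node As Bs
              | true :: s' => s_sel algA s' | false :: s' => s_sel algB s' end)).
  move=> s alg opsE selE sel.
  have ops0 : s_ops alg s = os ++ open_ops A B oa ob oc by rewrite -[s]cats0 opsE.
  have sel0 : s_sel alg s = Node As Bs by rewrite -[s]cats0 selE.
  have inF1 : List.In (Node As Bs) F1.
    by apply: Permutation_in (Permutation_sym pm1) _; left.
  have sA : edges A \subset edges As.
    by apply/subsetP => e; rewrite !edges_attach => ->.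
  have sB : edges B \subset edges Bs.
    by apply/subsetP => e; rewrite !edges_attach => ->.
  have sz : size (os ++ open_ops A B oa ob oc) <= 9.
    rewrite size_cat (leq_add os4 (n2 := 5)) //= !size_cat.
    by case: (oa) (ob) (oc) => [?|] [?|] [?|].
  have dis : [disjoint edges As & edges Bs] by case: vtop.
  have bound t n : height t <= maxn (height A) (height B) ->
      n <= 10 * (height t).+1 ->
      size (s_ops alg s) + 1 + n <= 10 * (height (Node A B)).+1.
    move=> ht hn; rewrite ops0 [height (Node A B)]/= mulnS; apply: leq_add.
      by rewrite addn1.
    by rewrite (leq_trans hn) // leq_mul2l.
  have := @d_sel _ ET dT sel alg A B As Bs s F F1; rewrite ops0 => Dsel.
  have {}Dsel := Dsel _ _ _ _ ex1 ns sel0 inF1 sA sB cover.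
  case E: (sel (Node As Bs)) Dsel => Dsel.
    have [||ch [n [G [e [D hn [eA he] che uniq]]]]] := HA (rcons s true) alg _ _ sel.
    - by move=> s'; rewrite cat_rcons opsE.
    - by move=> s'; rewrite cat_rcons selE.
    have := Dsel _ _ _ _ D; rewrite -ops0 => Dn.
    exists (edges As :: ch), (size (s_ops alg s) + 1 + n), G, e; split=> //.
    - exact: bound (leq_maxl _ _) hn.
    - by rewrite /= inE eA.
    - by move=> X /predU1P[->|/che] //; apply: (subsetP sA).
    (* The first chosen cluster [As] is edge-disjoint from [Bs], which rules out the edges of
       [B]. *)
    move=> e' /setUP[e'A|e'B] he' inch.
      by apply: uniq => // X Xch; apply: inch; rewrite inE Xch orbT.
    have := inch _ (mem_head _ _).
    by rewrite (disjointFl dis (subsetP sB _ e'B)).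
  have [||ch [n [G [e [D hn [eB he] che uniq]]]]] := HB (rcons s false) alg _ _ sel.
  - by move=> s'; rewrite cat_rcons opsE.
  - by move=> s'; rewrite cat_rcons selE.
  have := Dsel _ _ _ _ D; rewrite -ops0 => Dn.
  exists (edges Bs :: ch), (size (s_ops alg s) + 1 + n), G, e; split=> //.
  - exact: bound (leq_maxr _ _) hn.
  - by rewrite /= inE eB orbT.
  - by move=> X /predU1P[->|/che] //; apply: (subsetP sB).
  move=> e' /setUP[e'A|e'B] he' inch.
    have := inch _ (mem_head _ _).
    by rewrite (disjointFr dis (subsetP sA _ e'A)).
  by apply: uniq => // X Xch; apply: inch; rewrite inE Xch orbT.
(* From here on some child does not hit, which forces two external boundary vertices. *)
have d2 : 1 < #|dT|.
  by rewrite ltnNge; apply: contra nboth => d1; rewrite !hits_small.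
have {}pcA := pcA d2; have {}pcB := pcB d2.
have nns : ~ needsel ET dT A B.
  case=> [|[/pcA hA /pcB hB]]; first by rewrite leqNgt d2.
  by rewrite hA hB in nboth.
have bound t s n (o : seq (op V)) : size s <= 4 -> size o <= 3 ->
    height t <= maxn (height A) (height B) ->
    n <= 10 * (height t).+1 ->
    size (s ++ o) + n <= 10 * (height (Node A B)).+1.
  move=> s4 o3 ht hn; rewrite [height (Node A B)]/= mulnS size_cat; apply: leq_add.
    exact: leq_trans (leq_add s4 o3) _.
  by rewrite (leq_trans hn) // leq_mul2l.
have pmF : Permutation (Node A B :: trees L)
    (Node A B :: trees (seq_of_opt oa ++ seq_of_opt ob ++ seq_of_opt oc)).
  exact: perm_skip.
have [hA|nA] := boolP (hits (edges A)).
  have nB : ~~ hits (edges B) by rewrite hA in nboth.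
  set o := OSplit (Node A B) :: force_ops B ob oc.
  have o3 : size o <= 3 by rewrite /= !size_cat; case: (ob) (oc) => [?|] [?|].
  have [F1 ex1 pm1] :
      runs (os ++ o) F (A :: trees (rcons (seq_of_opt oa) (c, attach (attach B ob) oc))).
    apply: runs_cat ros _; apply: runs_cons_split pmF _.
    exact: (runs_force f hA (Permutation_refl _)).
  have [algA HA] : searchable A F1.
    by apply: (IHA F1 [::]) (fork_child treeET f hA) (hA) _ _ => //; apply: runs_nil.
  (* The final [A] is a placeholder: [select] is not called at this address. *)
  exists (SearchAlg
    (fun s => if s is _ :: s' then s_ops algA s' else os ++ o)
    (fun s => if s is _ :: s' then s_sel algA s' else A)).
  move=> s alg opsE selE sel.
  have ops0 : s_ops alg s = os ++ o by rewrite -[s]cats0 opsE.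
  have [||ch [n [G [e [D hn [eA he] che uniq]]]]] := HA (rcons s true) alg _ _ sel.
  - by move=> s'; rewrite cat_rcons opsE.
  - by move=> s'; rewrite cat_rcons selE.
  exists ch, (size (s_ops alg s) + n), G, e; split=> //.
  - by apply: d_forcedL D => //; [rewrite ops0|apply/pcA].
  - by rewrite ops0; apply: bound (leq_maxl _ _) hn.
  - by rewrite /= inE eA.
  (* The sibling [B] does not hit, so none of its edges is a candidate. *)
  move=> e' /setUP[e'A|e'B] he' inch; first exact: uniq.
  by rewrite (negPf (not_hits nB he')) in e'B.
have hB : hits (edges B) by rewrite hitsU // (negPf nA) in hAB.
set o := OSplit (Node A B) :: force_ops A oa oc.
have o3 : size o <= 3 by rewrite /= !size_cat; case: (oa) (oc) => [?|] [?|].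
have [F1 ex1 pm1] :
    runs (os ++ o) F (B :: trees (rcons (seq_of_opt ob) (c, attach (attach A oa) oc))).
  apply: runs_cat ros _; apply: runs_cons_split pmF _; apply: (runs_force f' hB).
  by rewrite !map_cat; case: (oa) (ob) (oc) => [?|] [?|] [?|]; solve_perm.
have [algB HB] : searchable B F1.
  by apply: (IHB F1 [::]) (fork_child treeET f' hB) (hB) _ _ => //; apply: runs_nil.
exists (SearchAlg
  (fun s => if s is _ :: s' then s_ops algB s' else os ++ o)
  (fun s => if s is _ :: s' then s_sel algB s' else A)).
move=> s alg opsE selE sel.
have ops0 : s_ops alg s = os ++ o by rewrite -[s]cats0 opsE.
have [||ch [n [G [e [D hn [eB he] che uniq]]]]] := HB (rcons s false) alg _ _ sel.
- by move=> s'; rewrite cat_rcons opsE.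
- by move=> s'; rewrite cat_rcons selE.
exists ch, (size (s_ops alg s) + n), G, e; split=> //.
- apply: d_forcedR D => //; [by rewrite ops0| |by apply/pcB].
  by move/pcA; apply/negP.
- by rewrite ops0; apply: bound (leq_maxr _ _) hn.
- by rewrite /= inE eB orbT.
move=> e' /setUP[e'A|e'B] he' inch; last exact: uniq.
by rewrite (negPf (not_hits nA he')) in e'A.
Qed.

Lemma valid_searchable t L F os :
  valid t -> surrounds ET dT (edges t) L -> hits (edges t) -> size os <= 4 ->
  runs os F (t :: trees L) -> searchable t F.
Proof.
elim: t L F os => [e|A IHA B IHB] L F os vt sur ht os4 ros.
  exact: searchable_leaf.
have [vA vB _ _ _] := vt; apply: (searchable_node vt sur ht os4 ros).
  by move=> F1 os1 L1; apply: IHA.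
by move=> F1 os1 L1; apply: IHB.
Qed.

Lemma on_pathE x y e :
  x \in dT -> y \in dT -> on_path ET x y e <-> e \in ET /\ separates e x y.
Proof.
move=> xd yd; have [xE yE] := (subsetP dTsub x xd, subsetP dTsub y yd).
apply: on_path_subtreeE => //; split=> //; exact: verts_neq0 xE.
Qed.

Lemma hits_top : hits ET.
Proof.
apply/hitsP => x y xd yd xy; have [_ cE _] := treeET.
have := cE x y (subsetP dTsub x xd) (subsetP dTsub y yd).
case/connectP => p0 pth0 lst0; case: (shortenP pth0) lst0 => p pth up _ lst.
case: p pth up lst => [|z p] pth up lst; first by rewrite lst eqxx in xy.
(* Any edge of the path from [x] to [y] would do; the first one is taken. *)
have /(on_pathE _ xd yd)[] : on_path ET x y [set x; z].
  by exists (z :: p); split=> //=; rewrite inE eqxx.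
by exists [set x; z].
Qed.

End Search.

Theorem theorem3p1 :
  exists c : nat,
  forall (V : finType) (ET : {set {set V}}) (dT : {set V}) (R : ttree V),
  top_tree ET dT R ->
  exists alg : search_alg V,
  forall select : ttree V -> bool,
  exists (chosen : seq {set {set V}}) (n : nat) (F : seq (ttree V)) (e : {set V}),
  [/\ descent ET dT select alg R [::] [:: R] chosen n F e,
      n <= c * (height R).+1,
      (#|dT| <= 1 ->
         [/\ e \in ET, (forall X, X \in chosen -> e \in X)
           & forall e', e' \in ET -> (forall X, X \in chosen -> e' \in X) -> e' = e]),
      (forall x y, x != y -> dT = [set x; y] ->
         [/\ on_path ET x y e, (forall X, X \in chosen -> e \in X)
           & forall e', on_path ET x y e' -> (forall X, X \in chosen -> e' \in X) -> e' = e])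
    & exists os : seq (op V), size os <= c * (height R).+1 /\ exec ET dT os F [:: R]].
Proof.
exists 10 => V ET dT R [treeET dTsub dT2 vR eR].
(* Initially nothing lies outside the current cluster. *)
have sur : surrounds ET dT (edges R) [::].
  split=> //; first by constructor.
  by move=> e; rewrite -eR; left.
have hR : hits ET dT (edges R) by rewrite eR; apply: hits_top.
have [alg H] := valid_searchable treeET dT2 dTsub (os := [::]) vR sur hR isT
                  (runs_nil ET dT (Permutation_refl [:: R])).
exists alg => select.
have [//|//|ch [n [F [e [D hn [eE he] che uniq]]]]] := H [::] alg _ _ select.
rewrite eR in eE uniq; exists ch, n, F, e; split=> //.
- by move=> d1; split=> // e' e'E; apply: uniq => //; apply: hits_small.
- move=> x y xy dE.
  have pE e' : on_path ET x y e' <-> e' \in ET /\ separates ET e' x y.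
    by apply: (on_pathE treeET dTsub); rewrite dE ?set21 ?set22.
  (* For a single edge of the tree, hitting thus amounts to lying on the path from [x] to [y], and
     uniqueness carries over. *)
  have hE e' : hits ET dT [set e'] = separates ET e' x y.
    rewrite (hits_pair _ _ xy dE); apply/exists_inP/idP => [[f /set1P->] //|sep].
    by exists e'; rewrite ?set11.
  split=> // [|e' /pE[e'E sep]]; first by apply/pE; rewrite -hE.
  by apply: uniq => //; rewrite hE.
(* Restoration undoes the joins and splits of the search, at most [n] in number, so the same bound
   applies. *)
have [os sz ex] := descent_exec D.
have vF : all_valid ET dT [:: R] by move=> t /= [<-|[]].
have [os' sz' ros] := exec_reverse vF ex.
by exists os'; split; [rewrite sz' (leq_trans sz)|apply: runs_exec1].
Qed.
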